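(* Let $f$ be a multiplicative graph invariant with $f(K_2)\neq f(2K_1)$, where $2K_1$ is the edgeless graph on two vertices. Then for every graph $G$, $$es_f(G)\leq \min\{d(x)+d(y)-1 : xy\in E(G)\text{ and } f(G-\{x,y\})\neq 0\}.$$
   Context: All graphs are finite and simple (the graph with no vertices is allowed). An invariant is a function $f$ from graphs to $[0,\infty)$ that is constant on isomorphism classes. $f$ is multiplicative if $f(H_1\sqcup H_2)=f(H_1)\cdot f(H_2)$ for all disjoint graphs $H_1,H_2$, where $\sqcup$ is disjoint union. $d(x)$ is the degree of $x$ in $G$. The $f$-edge stability number is $es_f(G)=\min\{|Y|: Y\subseteq E(G),\ f(G-Y)\neq f(G)\}$, and $es_f(G)=\infty$ if $f(G-Y)=f(G)$ for all $Y\subseteq E(G)$. The minimum of an empty set is $\infty$. *)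

(* Defs.v *)
From HB Require Import structures.
From mathcomp Require Import all_boot all_order all_algebra.
From mathcomp Require Import reals constructive_ereal.

Set Implicit Arguments.
Unset Strict Implicit.
Unset Printing Implicit Defensive.

Import Order.TTheory GRing.Theory Num.Theory.
Local Open Scope ring_scope.
Local Open Scope ereal_scope.

Record sgraph := SGraph {
  vertex :> finType;
  adj : rel vertex;
  adj_sym : symmetric adj;
  adj_irrefl : irreflexive adj
}.

Definition isomorphic (G H : sgraph) : Prop :=
  exists2 h : G -> H, bijective h & forall x y, adj (h x) (h y) = adj x y.

Definition degree (G : sgraph) (x : G) : nat := #|[set y | adj x y]|.

Definition edges (G : sgraph) : {set {set G}} :=
  [set [set p.1; p.2] | p : G * G & adj p.1 p.2].

Section DeleteEdges.
Variables (G : sgraph) (Y : {set {set G}}).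

Definition del_edges_adj : rel G :=
  fun x y => adj x y && ([set x; y] \notin Y).

Lemma del_edges_sym : symmetric del_edges_adj.
Proof. by move=> x y; rewrite /del_edges_adj adj_sym finset.setUC. Qed.

Lemma del_edges_irrefl : irreflexive del_edges_adj.
Proof. by move=> x; rewrite /del_edges_adj adj_irrefl. Qed.

Definition del_edges : sgraph := SGraph del_edges_sym del_edges_irrefl.
End DeleteEdges.

Section DeleteVertices.
Variables (G : sgraph) (S : {set G}).

Definition del_vertices_adj : rel {z : G | z \notin S} :=
  fun u v => adj (val u) (val v).

Lemma del_vertices_sym : symmetric del_vertices_adj.
Proof. by move=> u v; apply: adj_sym. Qed.

Lemma del_vertices_irrefl : irreflexive del_vertices_adj.
Proof. by move=> u; apply: adj_irrefl. Qed.

Definition del_vertices : sgraph :=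
  SGraph del_vertices_sym del_vertices_irrefl.
End DeleteVertices.

Section DisjointUnion.
Variables G H : sgraph.

Definition disjoint_union_adj : rel (G + H)%type :=
  fun u v => match u, v with
  | inl x, inl y => adj x y
  | inr x, inr y => adj x y
  | _, _ => false
  end.

Lemma disjoint_union_sym : symmetric disjoint_union_adj.
Proof. by move=> [x|x] [y|y] //=; apply: adj_sym. Qed.

Lemma disjoint_union_irrefl : irreflexive disjoint_union_adj.
Proof. by move=> [x|x] /=; apply: adj_irrefl. Qed.

Definition disjoint_union : sgraph :=
  SGraph disjoint_union_sym disjoint_union_irrefl.
End DisjointUnion.

Section Complete.
Variable n : nat.

Definition complete_adj : rel 'I_n := fun x y => x != y.

Lemma complete_sym : symmetric complete_adj.
Proof. by move=> x y; rewrite /complete_adj eq_sym. Qed.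

Lemma complete_irrefl : irreflexive complete_adj.
Proof. by move=> x; rewrite /complete_adj eqxx. Qed.

Definition complete : sgraph := SGraph complete_sym complete_irrefl.

Definition edgeless_adj : rel 'I_n := fun _ _ => false.

Lemma edgeless_sym : symmetric edgeless_adj.
Proof. by []. Qed.

Lemma edgeless_irrefl : irreflexive edgeless_adj.
Proof. by []. Qed.

Definition edgeless : sgraph := SGraph edgeless_sym edgeless_irrefl.
End Complete.

Definition graph_invariant (R : realType) (f : sgraph -> R) : Prop :=
  (forall G, (0 <= f G)%R) /\ (forall G H, isomorphic G H -> f G = f H).

(* Disjoint graphs are modelled by the sum of their vertex types; for an
   isomorphism invariant this loses no generality. *)
Definition multiplicative (R : realType) (f : sgraph -> R) : Prop :=
  forall H1 H2, f (disjoint_union H1 H2) = (f H1 * f H2)%R.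

(* The minimum is taken over a finite family of extended reals, with value +oo
   when the family is empty. *)
Definition edge_stability (R : realType) (f : sgraph -> R) (G : sgraph)
    : \bar R :=
  \big[mine/+oo]_(Y in powerset (edges G) | f (del_edges Y) != f G)
    (#|Y|%:R)%:E.

(* Main.v *)
(** Let [xy] be an edge with [f (G - {x, y}) <> 0].  Deleting all edges meeting
    [{x, y}] leaves [2 K_1] plus [G - {x, y}], and sparing [xy] leaves [K_2]
    plus [G - {x, y}].  By multiplicativity [f] takes distinct values on these
    two graphs, so one of them differs from [f G]; at most [d(x) + d(y) - 1]
    edges were deleted. *)

Require Import Defs.
From mathcomp Require Import all_boot all_order all_algebra.
From mathcomp Require Import reals constructive_ereal.
Local Open Scope ring_scope.
Local Open Scope ereal_scope.

Set Implicit Arguments.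
Unset Strict Implicit.
Unset Printing Implicit Defensive.

Definition incident_edges (G : sgraph) (S : {set G}) : {set {set G}} :=
  [set e in edges G | ~~ [disjoint e & S]].

Lemma mem_edges (G : sgraph) (u v : G) : adj u v -> [set u; v] \in edges G.
Proof. by move=> uv; apply/imsetP; exists (u, v); rewrite ?inE. Qed.

Lemma mem_incident_edges (G : sgraph) (S : {set G}) (u v : G) : adj u v ->
  ([set u; v] \in incident_edges S) = (u \in S) || (v \in S).
Proof.
move=> uv; rewrite inE mem_edges //= -setI_eq0.
apply/set0Pn/orP => [[z]|[uS|vS]].
- by rewrite !inE => /andP[/orP[]/eqP -> ?]; [left|right].
- by exists u; rewrite !inE eqxx.
- by exists v; rewrite !inE eqxx orbT.
Qed.

(** The edge [xy] is counted by both degrees but is a single edge. The strict inequality carries the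
    [- 1] of the bound without truncated subtraction. *)
Lemma card_incident_edges2 (G : sgraph) (x y : G) : adj x y ->
  (#|incident_edges [set x; y]| < degree x + degree y)%N.
Proof.
move=> xy; pose Nx := [set z | adj x z]; pose Ny := [set z | adj y z].
have xNy : x \in Ny by rewrite inE adj_sym.
have sub : incident_edges [set x; y] \subset
    [set [set x; z] | z in Nx] :|: [set [set y; z] | z in Ny :\ x].
  have edgeP u v : adj u v -> u \in [set x; y] -> [set u; v] \in
      [set [set x; z] | z in Nx] :|: [set [set y; z] | z in Ny :\ x].
    move=> uv; rewrite !inE => /orP[]/eqP eu; rewrite {}eu in uv *.
      by apply/orP; left; apply: imset_f; rewrite inE.
    (* The edge [yx] is counted among the edges at [x], so only neighbours of [y] other than [x] are
       needed in the second set. *)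
    have [->|vx] := eqVneq v x.
      by rewrite setUC; apply/orP; left; apply: imset_f; rewrite inE.
    by apply/orP; right; apply: imset_f; rewrite !inE vx.
  apply/subsetP => e; rewrite inE => /andP[/imsetP[[u v]]].
  rewrite inE /= => uv -> meet.
  have : [set u; v] \in incident_edges [set x; y] by rewrite inE mem_edges.
  rewrite mem_incident_edges // => /orP[uS|vS]; first exact: edgeP.
  by rewrite setUC; apply: edgeP => //; rewrite adj_sym.
apply: leq_ltn_trans (subset_leq_card sub) _.
apply: leq_ltn_trans (leq_card_setU _ _) _.
rewrite {2}/degree -/Ny (cardsD1 x Ny) xNy add1n addnS ltnS.
by apply: leq_add; apply: leq_imset_card.
Qed.

(** [A] holds the edges spared inside [S], and [H] is the graph they form there. As no member of [A]
    leaves [S], every edge between [S] and its complement is deleted, while edges avoiding [S] all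
    survive. Taking [A] empty or [A] the single edge [xy] gives the two graphs to compare. *)
Lemma isomorphic_del_incident_edges (G H : sgraph) (S : {set G})
    (A : {set {set G}}) (h : H -> G) :
  injective h -> h @: [set: H] = S -> A \subset powerset S ->
  (forall i j, adj (h i) (h j) && ([set h i; h j] \in A) = adj i j) ->
  isomorphic (disjoint_union H (del_vertices S))
             (del_edges (incident_edges S :\: A)).
Proof.
move=> h_inj im_h AS adjH.
have hS i : h i \in S by rewrite -im_h imset_f.
have outA u v : v \notin S -> [set u; v] \notin A.
  apply: contraNN => /(subsetP AS); rewrite powersetE => /subsetP; apply.
  by rewrite !inE eqxx orbT.
pose Y := incident_edges S :\: A.
have adjHS u v : u \in S -> v \notin S -> del_edges_adj Y u v = false.
  move=> uS vS; apply/andP => -[uv].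
  by rewrite finset.in_setD outA // mem_incident_edges // uS.
pose g (w : disjoint_union H (del_vertices S)) : del_edges Y :=
  match w with inl i => h i | inr u => val u end.
exists g; last first.
  move=> [i|u] [j|v] /=.
  - rewrite -adjH /del_edges_adj; case uv: (adj _ _) => //=.
    by rewrite finset.in_setD mem_incident_edges // hS andbT negbK.
  - exact: adjHS (hS i) (valP v).
  - by rewrite del_edges_sym; apply: adjHS (hS j) (valP u).
  - rewrite /del_edges_adj /del_vertices_adj; case uv: (adj _ _) => //=.
    rewrite finset.in_setD mem_incident_edges //.
    by rewrite (negbTE (valP u)) (negbTE (valP v)) andbF.
(* Injectivity holds because [h] lands in [S] and [val] outside it; surjectivity follows by counting
   vertices. *)
apply: inj_card_bij => [[i|u] [j|v] /= e|].
- by rewrite (h_inj _ _ e).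
- by have := hS i; rewrite e (negbTE (valP v)).
- by have := hS j; rewrite -e (negbTE (valP u)).
- by rewrite (val_inj e).
rewrite card_sum card_sig -(cardsC S) -im_h card_imset // cardsT leq_add2l.
by apply: subset_leq_card; apply/subsetP => u; rewrite !inE.
Qed.

Section EdgeEnds.
Variables (G : sgraph) (x y : G).
Hypothesis xy : adj x y.

Let h (i : 'I_2) : G := if i == ord0 then x else y.

Let ends_neq : x != y.
Proof. by apply: contraTneq xy => ->; rewrite adj_irrefl. Qed.

Let h_inj : injective h.
Proof.
by move=> [[|[|//]] ?] [[|[|//]] ?] /= /eqP;
  rewrite /h /= ?(eq_sym y) ?(negbTE ends_neq) // => _; apply: val_inj.
Qed.

Let im_h : h @: [set: 'I_2] = [set x; y].
Proof.
apply/setP => z; rewrite !inE; apply/imsetP/orP.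
  by move=> [i _ ->]; rewrite /h; case: ifP => _; [left|right].
by move=> [] /eqP ->; [exists ord0|exists ord_max]; rewrite ?inE.
Qed.

Lemma isomorphic_del_incident_edges2 :
  isomorphic (disjoint_union (edgeless 2) (del_vertices [set x; y]))
             (del_edges (incident_edges [set x; y])).
Proof.
rewrite -[incident_edges _]setD0.
apply: (@isomorphic_del_incident_edges _ (edgeless 2)) h_inj im_h _ _.
  exact: sub0set.
by move=> i j; rewrite inE andbF.
Qed.

Lemma isomorphic_del_incident_edges2_but_one :
  isomorphic (disjoint_union (complete 2) (del_vertices [set x; y]))
             (del_edges (incident_edges [set x; y] :\ [set x; y])).
Proof.
apply: (@isomorphic_del_incident_edges _ (complete 2)) h_inj im_h _ _.
  by rewrite sub1set powersetE.
(* Injectivity of [h] turns [i != j] into a comparison of the ends, leaving four cases. *)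
move=> i j; rewrite inE /= /complete_adj -(inj_eq h_inj) /h.
by do 2![case: ifP => _]; rewrite ?adj_irrefl ?eqxx ?ends_neq ?(eq_sym y)
  ?ends_neq ?(adj_sym y) ?xy ?(setUC [set y]) ?eqxx.
Qed.

End EdgeEnds.

Lemma edge_stability_le (R : realType) (f : sgraph -> R) (G : sgraph)
    (Y : {set {set G}}) :
  Y \subset edges G -> f (del_edges Y) != f G ->
  edge_stability f G <= (#|Y|%:R)%:E.
Proof.
by move=> YE fY; apply: Order.TotalTheory.bigmin_le_cond; rewrite powersetE YE.
Qed.

Theorem theorem3p2 (R : realType) (f : sgraph -> R)
    (f_inv : graph_invariant f) (f_mul : multiplicative f)
    (f_K2 : f (complete 2) <> f (edgeless 2)) (G : sgraph) :
  edge_stability f G <=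
  \big[mine/+oo]_(p : G * G | adj p.1 p.2 &&
                    (f (del_vertices [set p.1; p.2]) != 0%R))
    ((degree p.1 + degree p.2)%:R - 1)%R%:E.
Proof.
(* Being below the minimum means being below the default [+oo] and below every term. *)
apply: Order.POrderTheory.le_bigmin => [|[x y] /= /andP[xy f_rest]].
  exact: leey.
have [_ f_iso] := f_inv.
pose E1 := incident_edges [set x; y]; pose E2 := E1 :\ [set x; y].
have E1E : E1 \subset edges G by apply/subsetP => e; rewrite inE => /andP[].
have E21 : E2 \subset E1 by apply: subD1set.
have bound (Y : {set {set G}}) : Y \subset E1 -> f (del_edges Y) != f G ->
    edge_stability f G <= ((degree x + degree y)%:R - 1)%R%:E.
  move=> YE1 fY.
  apply: Order.POrderTheory.le_trans
    (edge_stability_le (subset_trans YE1 E1E) fY) _.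
  rewrite lee_fin Num.Theory.lerBrDr GRing.natr1 Num.Theory.ler_nat.
  exact: leq_ltn_trans (subset_leq_card YE1) (card_incident_edges2 xy).
(* If neither [E1] nor [E2] changed [f], cancelling the nonzero factor [f (G - {x, y})] would give
   [f] the same value on [K_2] and [2 K_1]. *)
have [f1|] := eqVneq (f (del_edges E1)) (f G); last exact: bound.
apply: (bound E2) => //; apply/eqP => f2; apply: f_K2.
apply: (GRing.mulIf f_rest).
rewrite -!f_mul (f_iso _ _ (isomorphic_del_incident_edges2 xy)).
by rewrite (f_iso _ _ (isomorphic_del_incident_edges2_but_one xy)) f1 f2.
Qed.
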